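(* For every integer $k\ge 3$ there exists $c_0>0$ such that for every $c\in(0,c_0)$ there exists $n_0$ such that for every $n\ge n_0$ with $k\mid n$ the following holds. If $G$ is a $k$-graph on $n$ vertices with $\delta(G) \ge (1/2-c)n$ and no perfect matching, then there is a partition of $V(G)$ into parts $V_1,V_2$, each of size at least $\delta(G)$, and $a \in \{0,1\}$ such that $|e \cap V_1| \equiv a \pmod 2$ for every edge $e$ of $G$.
   Context: A $k$-graph $G$ is a set of $k$-element subsets (edges) of a vertex set $V(G)$. Its minimum degree $\delta(G)$ is the largest $m$ such that every set of $k-1$ vertices is contained in at least $m$ edges. A perfect matching is a set of pairwise disjoint edges covering all vertices. *)

(* Defs.v *)
From mathcomp Require Import all_boot.
From Stdlib Require Import Reals.
Set Implicit Arguments. Unset Strict Implicit. Unset Printing Implicit Defensive.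

Definition kgraph (n k : nat) (G : {set {set 'I_n}}) : Prop :=
  forall e, e \in G -> #|e| = k.

Definition codeg (n : nat) (G : {set {set 'I_n}}) (S : {set 'I_n}) : nat :=
  #|[set e in G | S \subset e]|.

(* minimum (k-1)-degree: min over all (k-1)-subsets S of codeg G S
   (default #|G| if there are no (k-1)-subsets; irrelevant for n >= k-1). *)
Definition mindeg (n k : nat) (G : {set {set 'I_n}}) : nat :=
  \big[minn/#|G|]_(S : {set 'I_n} | #|S| == k.-1) codeg G S.

Definition has_perfect_matching (n : nat) (G : {set {set 'I_n}}) : Prop :=
  exists M : {set {set 'I_n}}, M \subset G /\ trivIset M /\ cover M = [set: 'I_n].

(* Main.v *)
Require Import Defs.
From Stdlib Require Import Reals Lra.
From mathcomp Require Import all_boot zify.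
Set Implicit Arguments. Unset Strict Implicit. Unset Printing Implicit Defensive.

(* Call x and y adjacent if a positive proportion of the (k-1)-sets complete both
   of them to an edge.  As degrees are close to 1/2, among any three vertices two
   are adjacent, and every vertex is adjacent to almost half of the others; hence
   either any two vertices can be exchanged (via a chain of adjacencies, in many
   ways), or V splits into two classes A and ~A of linear size within which they
   can.  Call i dense if a positive proportion of the k-sets are edges meeting A
   in i vertices; the degree condition makes i or i + 1 dense for every i < k.
   A k-set of dense type has many absorbers of constant size, so, by averaging,
   O(log n) disjoint absorbers chosen greedily serve all such sets at once, and
   constantly many rounds absorb any bounded collection of them.  An almost
   perfect matching of the remainder leaves fewer than 3k vertices, which
   together with reserved vertices are cut into sets of dense type.  If i and
   i + 1 are dense this always succeeds; if only i and i + 2 are, it needs a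
   parity condition, which can be corrected by one edge of the wrong parity,
   unless all edges have the same parity on A. *)

(** * Counting tuples *)

Section TupleSums.
Variable V : finType.
Implicit Types (s c : nat) (t : seq V) (F : seq V -> nat) (W : {set V}).

(* The sum of [F] over all [s]-tuples; by recursion, so that concatenating
   tuples amounts to iterating sums. *)
Fixpoint tsum s F : nat :=
  if s is s'.+1 then \sum_(x : V) tsum s' (fun t => F (x :: t)) else F [::].

Lemma leq_tsum s F F' :
  (forall t, size t = s -> F t <= F' t) -> tsum s F <= tsum s F'.
Proof.
elim: s F F' => [|s IHs] F F' leF /=; first exact: leF.
by apply: leq_sum => x _; apply: IHs => t st; apply: leF; rewrite /= st.
Qed.

Lemma eq_tsum s F F' :
  (forall t, size t = s -> F t = F' t) -> tsum s F = tsum s F'.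
Proof. by move=> eqF; apply/eqP; rewrite eqn_leq !leq_tsum // => t /eqF->. Qed.

Lemma tsum_const s c : tsum s (fun=> c) = #|V| ^ s * c.
Proof.
elim: s => [|s IHs] /=; first by rewrite mul1n.
by rewrite IHs sum_nat_const expnS mulnA.
Qed.

Lemma tsumD s F F' : tsum s (fun t => F t + F' t) = tsum s F + tsum s F'.
Proof.
elim: s F F' => [|s IHs] F F' //=.
by rewrite -big_split; apply: eq_bigr => x _; apply: IHs.
Qed.

Lemma tsumM s c F : tsum s (fun t => c * F t) = c * tsum s F.
Proof.
elim: s F => [|s IHs] F //=; rewrite big_distrr.
by apply: eq_bigr => x _; apply: IHs.
Qed.

Lemma tsum_sum s (I : finType) (P : pred I) (F : I -> seq V -> nat) :
  tsum s (fun t => \sum_(i | P i) F i t) = \sum_(i | P i) tsum s (F i).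
Proof.
elim: s F => [|s IHs] F //=; rewrite exchange_big.
by apply: eq_bigr => x _; apply: IHs.
Qed.

Lemma tsum_cat s s' F :
  tsum (s + s') F = tsum s (fun t => tsum s' (fun t' => F (t ++ t'))).
Proof.
elim: s F => [|s IHs] F //=.
by apply: eq_bigr => x _; apply: IHs.
Qed.

Lemma tsum_witness s F c :
  0 < c -> #|V| ^ s * c <= tsum s F -> 0 < #|V| -> exists2 t, size t = s & c <= F t.
Proof.
move=> c0 le_c V0.
have [/existsP [t /= ct]|no] := boolP [exists t : s.-tuple V, c <= F t].
  by exists t; rewrite ?size_tuple.
have: tsum s F <= tsum s (fun=> c.-1).
  apply: leq_tsum => t st; move/existsPn: no => /(_ (Tuple (introT eqP st))) /=.
  by rewrite -ltnNge => ?; lia.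
rewrite tsum_const => h; have: #|V| ^ s * c <= #|V| ^ s * c.-1 by lia.
by rewrite leq_pmul2l ?expn_gt0 ?V0 // => ?; lia.
Qed.

(** Sums run over all tuples, repetitions included; this singles out the injective ones that avoid
    used vertices. *)
Definition fresh W t := uniq t && all [predC W] t.

Lemma fresh_cons W x t :
  fresh W (x :: t) = [&& x \notin W, x \notin t & fresh W t].
Proof. by rewrite /fresh /=; case: (x \in t); case: (x \in W); rewrite ?andbF. Qed.

(** Union bound: each of the [s] entries repeats another one or falls into [W] with probability at
    most [(s + #|W|) / #|V|]. *)
Lemma tsum_not_fresh s W :
  tsum s (fun t => ~~ fresh W t) * #|V| <= s * (s + #|W|) * #|V| ^ s.
Proof.
elim: s => [|s IHs] //=.
have sum_mem t : \sum_x (x \in t : nat) <= size t.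
  rewrite -big_mkcond /= sum1_card; exact: card_size.
have sum_memW : \sum_x (x \in W : nat) = #|W|.
  by rewrite -big_mkcond /= sum1_card.
have: \sum_x tsum s (fun t => ~~ fresh W (x :: t)) <=
      #|W| * #|V| ^ s + s * #|V| ^ s + #|V| * tsum s (fun t => ~~ fresh W t).
  rewrite -tsum_sum.
  apply: (@leq_trans (tsum s (fun t => #|W| + s + #|V| * ~~ fresh W t))); last first.
    by rewrite tsumD tsum_const tsumM mulnDr; lia.
  apply: leq_tsum => t st; rewrite -sum_memW.
  apply: (@leq_trans (\sum_x ((x \in W) + (x \in t) + ~~ fresh W t))).
    by apply: leq_sum => x _; rewrite fresh_cons; case: (x \in W); case: (x \in t); case: fresh.
  rewrite !big_split /= sum_nat_const leq_add2r leq_add2l -st; exact: sum_mem.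
rewrite expnS; set B := tsum s _ in IHs *; set N := #|V| ^ s in IHs *.
set X := \sum_x _; nia.
Qed.

(** Non-fresh tuples make up at most half of the guaranteed proportion [1 / D]. *)
Lemma tsum_fresh s W D (P : pred (seq V)) :
  2 * D * (s * (s + #|W|)) <= #|V| -> #|V| ^ s <= D * tsum s (fun t => P t) ->
  #|V| ^ s <= 2 * D * tsum s (fun t => P t && fresh W t).
Proof.
move=> big dense; have [V0|V0] := posnP #|V|.
  case: s {big} dense => [|s _]; last by rewrite V0 exp0n.
  by rewrite !expn0 /= /fresh /= ?andbT; lia.
have: tsum s (fun t => P t : nat) <=
      tsum s (fun t => P t && fresh W t) + tsum s (fun t => ~~ fresh W t).
  by rewrite -tsumD; apply: leq_tsum => t _; case: (P t); case: fresh.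
have := tsum_not_fresh s W.
set A := tsum s _ in dense *; set B := tsum s _; set N := #|V| ^ s in dense *.
set C := tsum s _ => hB hA.
have: 2 * D * B <= N.
  rewrite -(leq_pmul2r V0) (leq_trans _ (leq_mul (leqnn N) big)) //.
  by rewrite -mulnA (leq_trans (leq_mul (leqnn _) hB)) //; lia.
by have := leq_mul (leqnn D) hA; rewrite mulnDr; lia.
Qed.

End TupleSums.

(** * Matchings *)

Lemma subset_of_card (V : finType) (A : {set V}) m :
  m <= #|A| -> exists2 S : {set V}, S \subset A & #|S| = m.
Proof.
move=> le_mA; exists [set:: take m (enum A)].
  by apply/subsetP=> x; rewrite inE => /mem_take; rewrite mem_enum.
rewrite cardsE; have /card_uniqP-> : uniq (take m (enum A)) by rewrite take_uniq ?enum_uniq.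
by rewrite size_take -cardE; case: ltnP; lia.
Qed.

Section Matchings.
Variables (V : finType) (k : nat) (G : {set {set V}}).
Hypotheses (k3 : 3 <= k) (Gk : forall e, e \in G -> #|e| = k).
Implicit Types (A B S T U W Y Z e : {set V}).

Definition matchable A :=
  [exists M : {set {set V}}, [&& M \subset G, trivIset M & cover M == A]].

Definition nbr S := [set y | y |: S \in G].

Lemma set_seq_cat (s t : seq V) : [set:: s ++ t] = [set:: s] :|: [set:: t].
Proof. by apply/setP=> x; rewrite !inE mem_cat. Qed.

Lemma matchable0 : matchable set0.
Proof.
by apply/existsP; exists set0; apply/and3P; split;
  rewrite ?sub0set /trivIset /cover ?big_set0 ?cards0.
Qed.

Lemma matchable_edge e : e \in G -> matchable e.
Proof.
by move=> eG; apply/existsP; exists [set e]; rewrite sub1set eG trivIset1 cover1 eqxx.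
Qed.

Lemma matchableU A B :
  matchable A -> matchable B -> [disjoint A & B] -> matchable (A :|: B).
Proof.
move=> /existsP[M /and3P[MG tM /eqP<-]] /existsP[M' /and3P[MG' tM' /eqP<-]] dMM'.
apply/existsP; exists (M :|: M').
by rewrite subUset MG MG' trivIsetU //= /cover bigcup_setU eqxx.
Qed.

Lemma card_cover_matching (M : {set {set V}}) : M \subset G -> trivIset M -> #|cover M| = #|M| * k.
Proof.
move=> /subsetP MG /eqP<-; rewrite -sum_nat_const.
by apply: eq_bigr => e /MG /Gk.
Qed.

Lemma dvdn_card_matchable A : matchable A -> k %| #|A|.
Proof.
by move=> /existsP[M /and3P[MG tM /eqP<-]]; rewrite card_cover_matching // dvdn_mull.
Qed.

Lemma nbr_notin S y : #|S| = k.-1 -> y \in nbr S -> y \notin S.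
Proof.
move=> cS; rewrite inE => /Gk; rewrite cardsU1 cS; case: (y \in S) => //=; lia.
Qed.

(** [Y] is what some matching inside [Z] leaves uncovered. *)
Definition leftover Z Y := (Y \subset Z) && matchable (Z :\: Y).

Lemma leftover_extend Z Y S y :
  leftover Z Y -> S \subset Y -> #|S| = k.-1 -> y \in nbr S -> y \in Y ->
  exists2 Y', leftover Z Y' & #|Y'| < #|Y|.
Proof.
case/andP=> YZ mY SY cS yS yY; rewrite inE in yS.
have yZ : y |: S \subset Y by rewrite subUset sub1set yY.
exists (Y :\: (y |: S)).
  rewrite /leftover (subset_trans (subsetDl _ _) YZ) setDDr.
  rewrite (setIidPr (subset_trans yZ YZ)); apply: matchableU => //.
    exact: matchable_edge.
  rewrite disjoint_sym disjoints_subset; apply: subset_trans yZ _.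
  by apply/subsetP=> z; rewrite !inE => ->.
rewrite cardsD (setIidPr yZ) (Gk yS); have := subset_leq_card yZ; rewrite (Gk yS).
by move: k3; clear; lia.
Qed.

(** Trading [e] for [u |: S] and [v |: S'] covers [2 * (k - 1)] new vertices and releases only the
    other [k - 2] vertices of [e]. *)
Lemma leftover_switch (M : {set {set V}}) Z Y e S S' u v :
  M \subset G -> trivIset M -> cover M = Z :\: Y -> Y \subset Z -> e \in M ->
  S \subset Y -> S' \subset Y -> [disjoint S & S'] -> #|S| = k.-1 -> #|S'| = k.-1 ->
  u \in nbr S :&: e -> v \in nbr S' :&: e -> u != v ->
  exists2 Y', leftover Z Y' & #|Y'| < #|Y|.
Proof.
move=> MG tM cM YZ eM SY S'Y dS cS cS'.
rewrite !inE => /andP[uS ue] /andP[vS ve] uv.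
have ec := Gk (subsetP MG _ eM).
have seZ x : x \in e -> (x \in Z) && (x \notin Y).
  have: e \subset Z :\: Y by rewrite -cM; apply: bigcup_sup eM.
  by move/subsetP/(_ x)=> h /h; rewrite inE andbC.
have sSY x : x \in S -> x \in Y by move/(subsetP SY).
have sSY' x : x \in S' -> x \in Y by move/(subsetP S'Y).
have sYZ x : x \in Y -> x \in Z by move/(subsetP YZ).
have dSx x : x \in S -> x \in S' -> False.
  by move=> xS; apply/negP; rewrite (disjointFr dS xS).
have [ueZ veZ] := (seZ _ ue, seZ _ ve).
exists ((Y :\: (S :|: S')) :|: (e :\: [set u; v])).
  apply/andP; split.
    by apply/subsetP=> x; rewrite !inE => /orP[/andP[_ /sYZ]|/andP[_ /seZ/andP[]]].
  have -> : Z :\: ((Y :\: (S :|: S')) :|: (e :\: [set u; v])) =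
            (cover (M :\ e) :|: (u |: S)) :|: (v |: S').
    rewrite coverD1 // cM; apply/setP=> x; rewrite !inE.
    have := seZ x; have := sSY x; have := sSY' x; have := sYZ x; have := dSx x.
    case: (eqVneq x u) => [->|_].
      by rewrite ue; case/andP: ueZ => -> /negbTE->; rewrite ?andbF ?orbF /= ?orbT.
    case: (eqVneq x v) => [->|_].
      by rewrite ve; case/andP: veZ => -> /negbTE->; rewrite ?andbF ?orbF /= ?orbT.
    case: (x \in e); case: (x \in S); case: (x \in S'); case: (x \in Y);
      case: (x \in Z) => //= h1 h2 h3 h4 h5;
      by [have := h5 isT | have := h4 isT | have := h3 isT | have := h2 isT | case: (h1 isT isT)].
  apply: matchableU; last first.
  - apply/pred0P=> x; rewrite /= coverD1 // cM !inE.
    apply/negP=> /andP[/orP[/and3P[xe xY xZ]|/orP[/eqP->|xS]] /orP[/eqP xv|xS']]; subst.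
    + by rewrite ve in xe.
    + by rewrite sSY' in xY.
    + by rewrite eqxx in uv.
    + by case/andP: (seZ _ ue) => _; rewrite sSY'.
    + by case/andP: (seZ _ ve) => _; rewrite sSY.
    + exact: dSx xS xS'.
  - exact: matchable_edge.
  apply: matchableU; last first.
  - apply/pred0P=> x; rewrite /= coverD1 // cM !inE.
    apply/negP=> /andP[/and3P[xe xY xZ] /orP[/eqP xv|xS']]; subst.
      by rewrite ue in xe.
    by rewrite sSY in xY.
  - exact: matchable_edge.
  apply/existsP; exists (M :\ e).
  by rewrite (subset_trans (subsetDl _ _) MG) trivIsetD ?eqxx.
rewrite cardsU (leq_ltn_trans (leq_subr _ _)) //.
have SSY : S :|: S' \subset Y by rewrite subUset SY.
have uve : [set u; v] \subset e by rewrite subUset !sub1set ue.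
rewrite !cardsD (setIidPr SSY) (setIidPr uve) cards2 uv ec.
have := subset_leq_card SSY; rewrite cardsU (disjoint_setI0 dS) cards0 cS cS'.
by move: k3; clear; lia.
Qed.

(* A leftover containing three disjoint (k-1)-sets can be shrunk: on average
   the three neighbourhoods meet some edge of the matching more than k times,
   so two of the sets attach to distinct vertices of that edge. *)
Lemma almost_perfect_matching Z d :
  (forall S, #|S| = k.-1 -> d <= #|nbr S :&: Z|) -> #|Z| < 3 * d ->
  exists Y, [/\ Y \subset Z, #|Y| < 3 * k.-1 & matchable (Z :\: Y)].
Proof.
move=> degZ Zd; have PZ : leftover Z Z by rewrite /leftover subxx setDv matchable0.
case: (arg_minnP (fun Y => #|Y|) PZ) => Y /andP[YZ mY] minY.
have {minY} minY Y' : leftover Z Y' -> #|Y'| < #|Y| -> False.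
  by move=> /minY; rewrite leqNgt => /negP.
exists Y; split=> //; rewrite ltnNge; apply/negP => bigY.
have [S1 S1Y c1] : exists2 S : {set V}, S \subset Y & #|S| = k.-1 by apply: subset_of_card; lia.
have [S2 S2Y c2] : exists2 S : {set V}, S \subset Y :\: S1 & #|S| = k.-1.
  by apply: subset_of_card; rewrite cardsD (setIidPr S1Y); lia.
have [S3 S3Y c3] : exists2 S : {set V}, S \subset Y :\: (S1 :|: S2) & #|S| = k.-1.
  apply: subset_of_card; rewrite cardsD; have := subset_leq_card (subsetIr Y (S1 :|: S2)).
  by have := cardsU S1 S2; move: bigY c1 c2; clear; lia.
move: S2Y S3Y; rewrite !subsetD disjoint_sym => /andP[S2Y d12] /andP[S3Y].
rewrite disjoint_sym disjoints_subset subUset -!disjoints_subset => /andP[d13 d23].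
have nbrY S : S \subset Y -> #|S| = k.-1 -> nbr S :&: Y = set0.
  move=> SY cS; apply/eqP; rewrite -subset0; apply/subsetP => y; rewrite inE.
  case/andP=> yS yY; have lY : leftover Z Y by apply/andP.
  by have [Y' /minY] := leftover_extend lY SY cS yS yY.
case/existsP: mY => M /and3P[MG tM /eqP cM].
have switch e S S' u v : e \in M -> S \subset Y -> S' \subset Y ->
    [disjoint S & S'] -> #|S| = k.-1 -> #|S'| = k.-1 ->
    u \in nbr S :&: e -> v \in nbr S' :&: e -> u != v -> False.
  move=> eM SY S'Y dS cS cS' uS vS' uv.
  by have [Y' /minY] := leftover_switch MG tM cM YZ eM SY S'Y dS cS cS' uS vS' uv.
pose a e S := #|nbr S :&: e|.
have ak e S : e \in M -> a e S <= k.
  by move=> /(subsetP MG)/Gk <-; apply/subset_leq_card/subsetIr.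
(* A vertex [v] of [e] attached to [S'] would differ from one of two vertices attached to [S],
   permitting a switch. *)
have cross e S S' : e \in M -> S \subset Y -> S' \subset Y -> [disjoint S & S'] ->
    #|S| = k.-1 -> #|S'| = k.-1 -> 1 < a e S -> a e S' = 0.
  move=> eM SY S'Y dS cS cS' /card_gt1P[u [u' [uS u'S uu']]].
  apply/eqP; rewrite cards_eq0 -subset0; apply/subsetP=> v vS'.
  have [uv|uv] := eqVneq u v; last by case: (switch e S S' u v).
  by case: (switch e S S' u' v); rewrite // -uv eq_sym.
have suma S : S \subset Y -> #|S| = k.-1 -> d <= \sum_(e in M) a e S.
  move=> SY cS; apply: leq_trans (degZ S cS) _.
  have -> : nbr S :&: Z = nbr S :&: cover M.
    rewrite cM; apply/setP=> x; rewrite !inE.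
    have/setP/(_ x) := nbrY S SY cS; rewrite !inE.
    by case: (x |: S \in G) => //= ->.
  rewrite -sum1_card (eq_bigl (fun x => (x \in cover M) && (x \in nbr S))); last first.
    by move=> x; rewrite inE andbC.
  rewrite big_trivIset_cond //=; apply: leq_sum => e _.
  by rewrite /a -sum1_card eq_leq //; apply: eq_bigl => x; rewrite in_setI andbC.
have: 3 * d <= \sum_(e in M) k.
  apply: (@leq_trans (\sum_(e in M) (a e S1 + a e S2 + a e S3))).
    by rewrite !big_split /= !mulSn addn0 addnA !leq_add ?suma.
  (* Either one count exceeds 1 and the others vanish, giving at most [k], or all are at most 1,
     giving at most 3. *)
  apply: leq_sum => e eM.
  have d21 : [disjoint S2 & S1] by rewrite disjoint_sym.
  have d31 : [disjoint S3 & S1] by rewrite disjoint_sym.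
  have d32 : [disjoint S3 & S2] by rewrite disjoint_sym.
  have := ak e S1 eM; have := ak e S2 eM; have := ak e S3 eM.
  have := cross e _ _ eM S1Y S2Y d12 c1 c2; have := cross e _ _ eM S1Y S3Y d13 c1 c3.
  have := cross e _ _ eM S2Y S1Y d21 c2 c1; have := cross e _ _ eM S2Y S3Y d23 c2 c3.
  have := cross e _ _ eM S3Y S1Y d31 c3 c1; have := cross e _ _ eM S3Y S2Y d32 c3 c2.
  by move: k3; clear; lia.
rewrite sum_nat_const -card_cover_matching // cM.
by have := subset_leq_card (subsetDl Z Y); move: Zd; clear; lia.
Qed.

End Matchings.

(** * Exchangeable vertices and absorption *)

Section Exchange.
Variables (V : finType) (k : nat) (G : {set {set V}}).
Hypotheses (k3 : 3 <= k) (Gk : forall e, e \in G -> #|e| = k).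
Implicit Types (s D : nat) (x y z : V) (t us vs : seq V) (T W : {set V}).
Local Notation n := #|V|.
Local Notation matchable := (matchable G).

Definition edge t := [set:: t] \in G.
Definition mseq t := uniq t && matchable [set:: t].

Lemma edge_cons y t : edge (y :: t) = (y |: [set:: t] \in G).
Proof. by rewrite /edge set_cons. Qed.

Lemma set_seq_perm t t' : perm_eq t t' -> [set:: t] = [set:: t'].
Proof. by move=> tt'; apply/setP=> x; rewrite !inE (perm_mem tt'). Qed.

Lemma edge_perm t t' : perm_eq t t' -> edge t = edge t'.
Proof. by move=> tt'; rewrite /edge (set_seq_perm tt'). Qed.

Lemma mseq_perm t t' : perm_eq t t' -> mseq t = mseq t'.
Proof. by move=> tt'; rewrite /mseq (set_seq_perm tt') (perm_uniq tt'). Qed.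

Lemma edge_uniq t : size t = k -> edge t -> uniq t.
Proof. by move=> st /Gk; rewrite cardsE => ct; apply/card_uniqP; rewrite st. Qed.

Lemma mseq_edge t : size t = k -> edge t -> mseq t.
Proof. by move=> st et; rewrite /mseq edge_uniq //= matchable_edge. Qed.

Lemma disjoint_set_seq t T : [disjoint [set:: t] & T] = all [predC T] t.
Proof.
apply/idP/allP => [/pred0P dT x xt | dT].
  by have := dT x; rewrite /= inE xt /= => ->.
by apply/pred0P=> x; rewrite /= inE; case: (boolP (x \in t)) => // /dT /= /negbTE.
Qed.

Lemma mseq_cat t t' : mseq t -> mseq t' -> uniq (t ++ t') -> mseq (t ++ t').
Proof.
move=> /andP[_ mt] /andP[_ mt'] utt'; rewrite /mseq utt' set_seq_cat matchableU //.
rewrite disjoint_set_seq; move: utt'; rewrite cat_uniq -all_predC => /and3P[_ tt' _].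
by apply/allP=> x xt; rewrite /= inE; apply: contraL xt => /(allP tt').
Qed.

(** An exchange gadget: [t] can be matched together with either vertex, leaving the other one
    free. *)
Definition swap x y t := mseq (x :: t) && mseq (y :: t).

Lemma swapC x y t : swap x y t = swap y x t.
Proof. exact: andbC. Qed.

Definition reach s D x y := n ^ s <= D * tsum s (fun t => swap x y t).

(** Gadgets are chained through a middle vertex [z], which joins the tuple: to cover [x], [z] goes
    to the second gadget; to cover [y], to the first. The factor 2 pays for making all vertices
    distinct. *)
Lemma reach_comp s s' D D' E x y :
  n <= E * #|[set z | reach s D x z && reach s' D' z y]| ->
  2 * (E * (D * D')) * ((s + s').+1 * ((s + s').+1 + 2)) <= n ->
  reach (s + s').+1 (2 * (E * (D * D'))) x y.
Proof.
move=> manyz big; rewrite /reach.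
pose P t := if t is z :: t' then swap x z (take s t') && swap z y (drop s t') else false.
have: n ^ (s + s').+1 <= E * (D * D') * tsum (s + s').+1 (fun t => P t).
  rewrite /= (eq_bigr (fun z =>
      tsum s (fun t => swap x z t : nat) * tsum s' (fun t => swap z y t : nat))); last first.
    move=> z _; rewrite tsum_cat mulnC -tsumM; apply: eq_tsum => t st.
    rewrite mulnC -tsumM; apply: eq_tsum => t' _.
    by rewrite -st take_size_cat // drop_size_cat // mulnb.
  rewrite expnS expnD; apply: (leq_trans (leq_mul manyz (leqnn _))).
  rewrite -!mulnA leq_mul2l -sum1_card !big_distrl !big_distrr /=; apply/orP; right.
  rewrite [X in _ <= X](bigID (mem [set z | reach s D x z && reach s' D' z y])) /=.
  apply: leq_trans (leq_addr _ _); apply: leq_sum => z; rewrite inE => /andP[rz rz'].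
  by rewrite mul1n mulnA mulnACA leq_mul.
move=> dense; apply: leq_trans (tsum_fresh (W := [set x; y]) _ dense) _.
  apply: leq_trans big; rewrite leq_mul2l; apply/orP; right.
  by rewrite leq_mul2l leq_add2l cards2 /=; case: (x != y).
rewrite leq_mul2l; apply/orP; right; apply: leq_tsum => -[|z t] //= [st].
case: andP => // -[/andP[/andP[mx mz] /andP[mz' my]]].
rewrite fresh_cons => /and3P[zxy zt /andP[ut txy]]; rewrite lt0b.
have zx : x != z by apply: contraNneq zxy => ->; rewrite !inE eqxx.
have zy : y != z by apply: contraNneq zxy => ->; rewrite !inE eqxx orbT.
have xt : x \notin t by apply/negP => /(allP txy); rewrite /= !inE eqxx.
have yt : y \notin t by apply/negP => /(allP txy); rewrite /= !inE eqxx orbT.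
apply/andP; split.
  rewrite (@mseq_perm _ ((x :: take s t) ++ (z :: drop s t))).
    apply: mseq_cat => //=; rewrite mem_cat inE (negbTE zx) /= -mem_cat cat_take_drop xt.
    by rewrite (perm_uniq (permEl (perm_catCA (take s t) [:: z] _))) /= cat_take_drop zt.
  rewrite /= perm_cons perm_sym -{3}(cat_take_drop s t).
  exact: permEl (perm_catCA (take s t) [:: z] _).
rewrite (@mseq_perm _ ((z :: take s t) ++ (y :: drop s t))).
  apply: mseq_cat => //.
  rewrite (perm_uniq (permEl (perm_catCA (z :: take s t) [:: y] _))) /=.
  by rewrite cat_take_drop inE negb_or zy yt zt.
rewrite perm_sym (permPl (permEl (perm_catCA (z :: take s t) [:: y] _))) /=.
by rewrite cat_take_drop.
Qed.

Fixpoint swaps s us vs t :=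
  match us, vs with
  | u :: us', v :: vs' => swap u v (take s t) && swaps s us' vs' (drop s t)
  | _, _ => true
  end.

Lemma swapsC s us vs t : swaps s us vs t = swaps s vs us t.
Proof. by elim: us vs t => [|u us IHs] [|v vs] t //=; rewrite swapC IHs. Qed.

(** The blocks of [t] serving different pairs are chosen independently, so the proportions
    multiply. *)
Lemma tsum_swaps s D us vs :
  size us = size vs -> all2 (reach s D) us vs ->
  n ^ (size us * s) <= D ^ size us * tsum (size us * s) (fun t => swaps s us vs t).
Proof.
elim: us vs => [|u us IHs] [|v vs] //= [suv] /andP[ruv /(IHs _ suv) IH].
rewrite mulSn tsum_cat expnD expnS.
rewrite (@eq_tsum _ s _ (fun t =>
   tsum (size us * s) (fun t => swaps s us vs t : nat) * swap u v t)).
  by rewrite tsumM; have := leq_mul ruv IH; congr (_ <= _); lia.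
move=> t st; rewrite [RHS]mulnC -tsumM; apply: eq_tsum => t' _.
by rewrite -st take_size_cat // drop_size_cat // mulnb.
Qed.

(** Each entry of [us] is matched with its own block; by [swapsC] the same tuple also serves
    [vs]. *)
Lemma swaps_mseq s us vs t :
  size us = size vs -> size t = size us * s -> swaps s us vs t ->
  uniq (us ++ t) -> mseq (us ++ t).
Proof.
elim: us vs t => [|u us IHs] [|v vs] //= t.
  by move=> _ /size0nil-> _ _; rewrite /mseq set_nil matchable0.
move=> [suv] st /andP[/andP[mu _] sw] /andP[ut uust].
have pt : perm_eq (u :: us ++ t) ((u :: take s t) ++ (us ++ drop s t)).
  rewrite /= perm_cons -{1}(cat_take_drop s t).
  exact: permEl (perm_catCA us (take s t) _).
have uu : uniq ((u :: take s t) ++ (us ++ drop s t)).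
  by rewrite -(perm_uniq pt) /= ut.
rewrite (mseq_perm pt) mseq_cat //; apply: IHs suv _ sw _.
  by rewrite size_drop st mulSn addKn.
by move: uu; rewrite cat_uniq => /and3P[].
Qed.

Definition absorb T t :=
  [&& matchable [set:: t], [disjoint [set:: t] & T] & matchable ([set:: t] :|: T)].

(* An absorber of [T] is an edge with the same class pattern as [T], together
   with one exchange gadget for each pair of corresponding vertices. *)
Lemma tsum_absorb s D E (c : V -> bool) vs :
  size vs = k -> uniq vs -> (forall x y, c x = c y -> reach s D x y) ->
  n ^ k <= E * tsum k (fun t => edge t && (map c t == map c vs)) ->
  2 * (E * D ^ k) * ((k + k * s) * ((k + k * s) + k)) <= n ->
  n ^ (k + k * s) <=
    2 * (E * D ^ k) * tsum (k + k * s) (fun t => absorb [set:: vs] t).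
Proof.
move=> svs uvs rc dense big.
have all2_reach us ws : map c us = map c ws -> all2 (reach s D) us ws.
  by elim: us ws => [|u us IHs] [|w ws] //= [cuw /IHs->]; rewrite rc.
pose P t := [&& edge (take k t), map c (take k t) == map c vs
               & swaps s (take k t) vs (drop k t)].
have: n ^ (k + k * s) <= E * D ^ k * tsum (k + k * s) (fun t => P t).
  rewrite expnD; apply: leq_trans (leq_mul dense (leqnn _)) _.
  rewrite -!mulnA leq_mul2l [tsum _ _ * _]mulnC -!tsumM tsum_cat.
  apply/orP; right; apply: leq_tsum => t st.
  have [/andP[et /eqP ct]|_] := boolP (edge t && _); last by rewrite muln0.
  have := @tsum_swaps s D t vs; rewrite st svs muln1 => /(_ erefl).
  rewrite all2_reach // => /(_ isT) H; apply: (leq_trans H).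
  rewrite -tsumM; apply: leq_tsum => t' _; rewrite leq_mul2l; apply/orP; right.
  rewrite /P -st take_size_cat // drop_size_cat //.
  by rewrite et ct eqxx.
move=> densePt; apply: leq_trans (tsum_fresh (W := [set:: vs]) _ densePt) _.
  have /card_uniqP cvs := uvs.
  by apply: leq_trans big; rewrite cardsE cvs svs.
rewrite leq_mul2l; apply/orP; right; apply: leq_tsum => t st.
have [/andP[/and3P[et /eqP ct sw] /andP[ut tvs]]|//] := boolP (P t && _).
rewrite lt0b; have stk : size (take k t) = k by rewrite size_take st; case: ltnP; lia.
have sdk : size (drop k t) = k * s by rewrite size_drop st addKn.
(* On its own, the tuple is matched by letting the gadgets cover the vertices of the leading
   edge. *)
have mt : mseq t.
  by rewrite -(cat_take_drop k t); apply: swaps_mseq sw _; rewrite ?stk ?cat_take_drop.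
have uvd : uniq (vs ++ drop k t).
  rewrite cat_uniq uvs drop_uniq // andbT /=; apply/hasPn=> x xd.
  by have /(allP tvs) := mem_drop xd; rewrite /= !inE.
have mvd : mseq (vs ++ drop k t).
  by rewrite swapsC in sw; apply: swaps_mseq sw uvd; rewrite ?svs.
have dtv : [disjoint [set:: t] & [set:: vs]] by rewrite disjoint_set_seq.
case/andP: mt => _ mt; apply/and3P; split=> //.
(* With [vs] added, the leading edge is used as an edge and the gadgets cover [vs] instead. *)
have -> : [set:: t] :|: [set:: vs] = [set:: take k t ++ (vs ++ drop k t)].
  rewrite -[in LHS](cat_take_drop k t) !set_seq_cat.
  by rewrite -setUA [X in _ :|: X]setUC.
suff: mseq (take k t ++ (vs ++ drop k t)) by case/andP.
apply: mseq_cat => //; first exact: mseq_edge.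
rewrite catA (perm_uniq (perm_cat (permEl (perm_catC _ _)) (perm_refl _))) -catA.
rewrite cat_take_drop cat_uniq uvs ut andbT /=.
by apply/hasPn=> x /(allP tvs); rewrite /= !inE.
Qed.

End Exchange.

(** * The absorbing method *)

(** By Bernoulli's inequality; with [q = 2 * D], every [q] greedy rounds halve the bound on the
    unserved family. *)
Lemma expn_pred_half q : 0 < q -> 2 * q.-1 ^ q <= q ^ q.
Proof.
case: q => // p _ /=.
have bern a : p ^ a * (p + a) <= p * p.+1 ^ a.
  by elim: a => [|a IHa]; rewrite ?addn0 ?mul1n ?muln1 // !expnS; nia.
have [->|p0] := posnP p; first by rewrite exp0n.
by have := bern p.+1; rewrite -(leq_pmul2l p0); nia.
Qed.

Lemma leq_bin_expn n k : 'C(n, k) <= n ^ k.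
Proof.
have: n ^_ k <= n ^ k.
  by elim: k => // k IHk; rewrite ffactnSr expnSr leq_mul ?leq_subr.
by apply: leq_trans; rewrite -bin_ffact leq_pmulr ?fact_gt0.
Qed.

Lemma disjoint_setUl (V : finType) (A B C : {set V}) :
  [disjoint A :|: B & C] = [disjoint A & C] && [disjoint B & C].
Proof. by rewrite !disjoints_subset subUset. Qed.

Lemma disjoint_setUr (V : finType) (A B C : {set V}) :
  [disjoint A & B :|: C] = [disjoint A & B] && [disjoint A & C].
Proof. by rewrite ![[disjoint A & _]]disjoint_sym disjoint_setUl. Qed.

Section Absorbing.
Variables (V : finType) (k : nat) (G : {set {set V}}).
Hypotheses (k3 : 3 <= k) (Gk : forall e, e \in G -> #|e| = k).
Implicit Types (A B T U W X Y Z e : {set V}).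
Local Notation n := #|V|.
Local Notation matchable := (matchable G).

Section Absorber.
Variables (good : pred {set V}) (m D : nat).
Hypothesis D0 : 0 < D.
Hypothesis good_card : forall T, good T -> #|T| = k.
Hypothesis good_absorb :
  forall T, good T -> n ^ m <= D * tsum m (fun t => absorb G T t).

(** Each member of [F] is absorbed by a proportion [1 / (2 * D)] of all tuples that are also fresh;
    on average a tuple thus serves that share of [F]. *)
Lemma greedy_step (F : {set {set V}}) W :
  F != set0 -> {in F, forall T, good T} -> 2 * D * (m * (m + #|W|)) <= n ->
  exists B, [/\ [disjoint B & W], #|B| <= m, matchable B &
    #|F| <= 2 * D * #|[set T in F | [disjoint B & T] && matchable (B :|: T)]|].
Proof.
move=> F0 Fgood big.
have n0 : 0 < n.
  have /set0Pn[T TF] := F0; apply: leq_trans (max_card (mem T)).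
  by rewrite (good_card (Fgood T TF)); lia.
pose f t := 2 * D * \sum_(T in F) (absorb G T t && fresh W t).
have: n ^ m * #|F| <= tsum m f.
  rewrite tsumM tsum_sum big_distrr /= mulnC -sum_nat_const.
  by apply: leq_sum => T /Fgood /good_absorb; apply: tsum_fresh.
case/tsum_witness => // [|t st]; first by rewrite card_gt0.
rewrite /f => le_Ff.
(* As [F] is nonempty, the tuple serves some member, which makes it matchable and disjoint from
   [W]. *)
have [T TF /andP[/and3P[mt _ _] /andP[_ tW]]] :
    exists2 T, T \in F & absorb G T t && fresh W t.
  apply/exists_inP; apply: contraNT F0; rewrite negb_exists_in => /forall_inP no.
  rewrite -cards_eq0 -leqn0 (leq_trans le_Ff) // big1 ?muln0 // => T /no.
  by case: (_ && _).
exists [set:: t]; split=> //; first by rewrite disjoint_set_seq.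
  by rewrite cardsE -st card_size.
apply: leq_trans le_Ff _; rewrite leq_mul2l; apply/orP; right.
rewrite -sum1dep_card big_mkcondr /=; apply: leq_sum => U _; rewrite /absorb mt /=.
by case: (_ && matchable _) => //; case: fresh.
Qed.

(** [F] collects the good sets not yet served; each round removes a share of at least [1 / (2 * D)].
    A served set stays served because the other pieces of [B] are matchable by themselves. *)
Lemma greedy_absorber j W :
  2 * D * (m * (m + (#|W| + m * j))) <= n ->
  exists B (F : {set {set V}}),
  [/\ [disjoint B & W], #|B| <= m * j, matchable B,
      forall T, good T -> T \notin F -> [disjoint B & T] -> matchable (B :|: T)
    & {in F, forall T, good T} /\
      #|F| * (2 * D) ^ j <= #|[set T | good T]| * (2 * D).-1 ^ j].
Proof.
elim: j => [|j IHj] big.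
  exists set0, [set T | good T]; rewrite cards0 matchable0; split=> //.
  - by rewrite disjoints_subset sub0set.
  - by move=> T gT; rewrite inE gT.
  - by split=> [T|]; rewrite ?inE.
case: IHj => [|B [F [BW cB mB Babs [Fgood cF]]]].
  by apply: leq_trans big; rewrite !leq_mul2l !leq_add2l leq_mul2l leqnSn !orbT.
have [F0|F0] := eqVneq F set0.
  exists B, F; split=> //; first by apply: leq_trans cB _; rewrite leq_mul2l leqnSn orbT.
  by split=> //; rewrite F0 cards0 mul0n.
have [|A [AW cA mA cFA]] := greedy_step (W := B :|: W) F0 Fgood.
  apply: leq_trans big; rewrite !leq_mul2l !leq_add2l; apply/orP; right.
  apply/orP; right; rewrite cardsU mulnS; lia.
move: AW; rewrite disjoint_setUr => /andP[AB AW].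
exists (B :|: A), (F :\: [set T in F | [disjoint A & T] && matchable (A :|: T)]).
split.
- by rewrite disjoint_setUl BW.
- by rewrite cardsU mulnS (leq_trans (leq_subr _ _)) // addnC leq_add.
- by rewrite matchableU // disjoint_sym.
- move=> T gT; rewrite !inE disjoint_setUl negb_and negbK.
  move=> TF /andP[BT AT]; have [TF'|TF'] := boolP (T \in F); last first.
    rewrite setUAC matchableU //; first exact: Babs.
    by rewrite disjoint_setUl [X in X && _]disjoint_sym AB disjoint_sym AT.
  move: TF; rewrite TF' AT orbF /= => mAT.
  by rewrite -setUA matchableU // disjoint_setUr BT disjoint_sym AB.
- split=> [T|]; first by rewrite !inE => /andP[_ /Fgood].
  set F' := [set T in F | _] in cFA *.
  have /subset_leq_card cF' : F' \subset F by apply/subsetP=> T; rewrite inE => /andP[].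
  rewrite cardsD (_ : F :&: F' = F'); last first.
    by apply/setIidPr/subsetP=> T; rewrite inE => /andP[].
  rewrite expnS expnSr !mulnA.
  have: (#|F| - #|F'|) * (2 * D) <= #|F| * (2 * D).-1.
    by move: cFA cF' D0; clear; case: D => // D' ; rewrite mulnBl; nia.
  move/(leq_mul (leqnn ((2 * D) ^ j))) => h.
  rewrite mulnAC; have := leq_mul cF (leqnn (2 * D).-1); move: h; clear; nia.
Qed.

(** After [2 * D * l] rounds the family has shrunk by a factor [2 ^ l], which exceeds its initial
    size, at most [n ^ k]; so it is empty. *)
Lemma absorber l W :
  n ^ k < 2 ^ l -> 2 * D * (m * (m + (#|W| + m * (2 * D * l)))) <= n ->
  exists B, [/\ [disjoint B & W], #|B| <= m * (2 * D * l), matchable B &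
    forall T, good T -> [disjoint B & T] -> matchable (B :|: T)].
Proof.
move=> nl /greedy_absorber[B [F [BW cB mB Babs [Fgood cF]]]].
exists B; split=> // T gT; apply: Babs => //.
suff -> : F = set0 by rewrite inE.
apply/eqP; rewrite -cards_eq0; apply: contraTT cF; rewrite -lt0n -ltnNge => F0.
have good_lt : #|[set T | good T]| < 2 ^ l.
  apply: leq_ltn_trans nl; apply: leq_trans (leq_bin_expn _ _).
  rewrite -card_draws subset_leq_card //; apply/subsetP=> U; rewrite !inE.
  by move/good_card->.
have q0 : 0 < 2 * D by rewrite muln_gt0.
have: 2 ^ l * (2 * D).-1 ^ (2 * D * l) <= (2 * D) ^ (2 * D * l).
  rewrite !(expnM _ (2 * D) l) -expnMn; have [->|l0] := posnP l; first by [].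
  by rewrite leq_exp2r // expn_pred_half.
move=> h; apply: leq_trans (leq_pmull _ F0); apply: leq_trans h.
by rewrite ltn_pmul2r // expn_gt0; apply/orP; left; move: D0; clear; lia.
Qed.

Fixpoint splits c U : Prop :=
  if c is c'.+1 then exists T, [/\ good T, T \subset U & splits c' (U :\: T)]
  else U = set0.

(** One of [C] disjoint absorbers is spent on each good set of the splitting; unspent ones are
    matchable alone. *)
Lemma splits_absorber l C W :
  n ^ k < 2 ^ l -> 2 * D * (m * (m + (#|W| + C * (m * (2 * D * l))))) <= n ->
  exists B, [/\ [disjoint B & W], #|B| <= C * (m * (2 * D * l)), matchable B &
    forall c U, c <= C -> [disjoint B & U] -> splits c U -> matchable (B :|: U)].
Proof.
move=> nl; elim: C => [|C IHC] big.
  exists set0; rewrite disjoints_subset sub0set cards0 matchable0; split=> // [[|//]] U _ _ ->.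
  by rewrite setU0 matchable0.
case: IHC => [|B [BW cB mB Babs]].
  by apply: leq_trans big; rewrite !leq_mul2l !leq_add2l leq_mul2r leqnSn !orbT.
case: (@absorber l (W :|: B)) => // [|A [AWB cA mA Aabs]].
  apply: leq_trans big; rewrite !leq_mul2l !leq_add2l; apply/orP; right; apply/orP; right.
  by rewrite mulSn addnC cardsU; move: cB; clear; lia.
move: AWB; rewrite disjoint_setUr => /andP[AW AB].
exists (B :|: A); split.
- by rewrite disjoint_setUl BW.
- by rewrite cardsU mulSn (leq_trans (leq_subr _ _)) // addnC leq_add.
- by rewrite matchableU // disjoint_sym.
- move=> [|c] U; first by move=> _ _ ->; rewrite setU0 matchableU // disjoint_sym.
  rewrite ltnS disjoint_setUl => cC /andP[BU AU] [T [gT TU sT]].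
  have UT : U = (U :\: T) :|: T by rewrite setUC -{1}(setID U T) (setIidPr TU).
  move: BU AU; rewrite {1 2}UT !disjoint_setUr => /andP[BU BT] /andP[AU AT].
  have BA : [disjoint B & A] by rewrite disjoint_sym.
  have UA : [disjoint U :\: T & A] by rewrite disjoint_sym.
  have UT' : [disjoint U :\: T & T].
    by rewrite disjoint_sym disjoints_subset; apply/subsetP=> x xT; rewrite !inE xT.
  rewrite {1}UT setUACA; apply: matchableU; [exact: Babs BU sT|exact: Aabs|].
  by rewrite disjoint_setUl !disjoint_setUr BT BA UA UT'.
Qed.
End Absorber.
End Absorbing.

(** * Cutting the leftover into sets of two good types *)

Section Endgame.
Variables (V : finType) (k : nat) (G : {set {set V}}).
Hypotheses (k3 : 3 <= k) (Gk : forall e, e \in G -> #|e| = k).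
Implicit Types (A B T U W X Y Z e : {set V}).
Local Notation n := #|V|.
Local Notation matchable := (matchable G).
Local Notation nbr := (nbr G).
Variables (A : {set V}) (i d : nat).
Hypothesis idk : i + d <= k.

Definition good_type T := (#|T| == k) && ((#|T :&: A| == i) || (#|T :&: A| == i + d)).

Lemma subset_of_type U a b :
  a <= #|U :&: A| -> b <= #|U :\: A| ->
  exists T, [/\ T \subset U, #|T| = a + b & #|T :&: A| = a].
Proof.
move=> ha hb; have [S SUA cS] := subset_of_card ha; have [S' SUA' cS'] := subset_of_card hb.
move: SUA SUA'; rewrite subsetI subsetD => /andP[SU SA] /andP[SU' SA'].
have S0 : S :&: S' = set0.
  by apply: disjoint_setI0; apply: disjointWl SA _; rewrite disjoint_sym.
exists (S :|: S'); rewrite subUset SU SU' cardsU S0 cards0 cS cS' subn0; split=> //.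
by rewrite setIUl (setIidPl SA) (disjoint_setI0 SA') setU0.
Qed.

(** Pieces are peeled off one at a time, [j] of them with [i + d] vertices in [A] and the rest with
    [i]; enough vertices remain outside [A] because [i + d <= k]. *)
Lemma splits_types c j U :
  #|U| = c * k -> #|U :&: A| = c * i + d * j -> j <= c -> splits good_type c U.
Proof.
elim: c j U => [|c IHc] j U cU cUA jc.
  by apply/eqP; rewrite -cards_eq0 cU.
have cUA' : #|U :\: A| = c.+1 * (k - i) - d * j by rewrite cardsD cU cUA mulnBr; lia.
(* The next piece has the larger type as long as one is still owed. *)
pose q : nat := 0 < j.
have [q1 qj jq] : [/\ q <= 1, q <= j & j - q <= c] 
  by move: jc; rewrite /q; case: (j) => [|j'] jc; split=> //=; move: jc; clear; lia.
have dq : d * q <= d by rewrite -[leqRHS]muln1 leq_mul2l q1 orbT.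
have dqj : d * q <= d * j by rewrite leq_mul2l qj orbT.
have djq : d * (j - q) <= (k - i) * c by apply: leq_mul => //; lia.
rewrite mulnBr in djq.
have [||T [TU cT cTA]] := @subset_of_type U (i + d * q) (k - (i + d * q)).
- by rewrite cUA mulSn; lia.
- by rewrite cUA' mulSn; lia.
rewrite subnKC in cT; last by lia.
exists T; split=> //.
  rewrite /good_type cT cTA eqxx /= eqn_add2l /q.
  by case: (j) => [|?]; rewrite ?muln0 ?muln1 ?addn0 eqxx ?orbT.
apply: (IHc (j - q)) => //.
  by rewrite cardsD (setIidPr TU) cU cT mulSn addKn.
by rewrite setIDAC cardsD cUA setIAC (setIidPr TU) cTA mulSn mulnBr; lia.
Qed.

Variables (m D l delta : nat) (e0 : {set V}).
Hypotheses (D0 : 0 < D) (d0 : 0 < d) (d2 : d <= 2).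
Hypothesis good_absorb :
  forall T, good_type T -> n ^ m <= D * tsum m (fun t => absorb G T t).
Hypothesis deg : forall S : {set V}, #|S| = k.-1 -> delta <= #|nbr S|.
Hypotheses (delta_large : 49 * n <= 100 * delta) (kn : k %| n) (e0G : e0 \in G).
Hypothesis e0_parity : d = 2 -> odd #|e0 :&: A| != odd i.
Hypotheses (A_large : i * (6 * k + 3) <= #|A :\: e0|) (AC_large : 6 * k * k <= #|~: A :\: e0|).
(** Bounds what is set aside: the reserve, the edge [e0] and [6 * k + 3] absorbers. *)
Let w := 6 * k * k + k + (6 * k + 3) * (m * (2 * D * l)).
Hypotheses (n_l : n ^ k < 2 ^ l) (n_w : 10 * w <= n) (n_greedy : 2 * D * (m * (m + w)) <= n).

(* The reserved set [R] lets the leftover be cut into good sets whatever its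
   distribution between the classes, up to parity; the parity is corrected by
   deciding whether [e0] is a matching edge or part of the leftover. *)
Lemma perfect_matching_of_absorption : matchable [set: V].
Proof.
have k0 : 0 < k by move: k3; clear; lia.
have n0 : 0 < n by apply: leq_trans (max_card (mem e0)); rewrite (Gk e0G).
(* There will be at most [6 * k + 3] pieces, so this reserve inside [A] can give each of them [i]
   vertices. *)
have [R1 R1A cR1] := subset_of_card A_large.
have r2 : 6 * k * k - i * (6 * k + 3) <= #|~: A :\: e0|.
  by apply: leq_trans AC_large; rewrite leq_subr.
have [R2 R2A cR2] := subset_of_card r2.
move: R1A R2A; rewrite !subsetD => /andP[R1A R1e] /andP[R2A R2e].
pose R := R1 :|: R2.
have Re : [disjoint R & e0] by rewrite disjoint_setUl R1e.
have R2A0 : R2 :&: A = set0 by apply: disjoint_setI0; rewrite disjoints_subset.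
have cRA : #|R :&: A| = i * (6 * k + 3) by rewrite setIUl R2A0 setU0 (setIidPl R1A).
have cR : #|R| = 6 * k * k.
  rewrite cardsU (_ : R1 :&: R2 = set0) ?cards0 ?subn0 ?cR1 ?cR2.
    have: i * (6 * k + 3) <= 6 * k * k by move: idk d0 k3; clear; nia.
    by clear; lia.
  by apply/eqP; rewrite -subset0 -R2A0 setIC setIS.
clearbody R.
have goodk T : good_type T -> #|T| = k by case/andP=> /eqP.
have [|B] := splits_absorber (C := 6 * k + 3) (W := R :|: e0) k3 D0 goodk good_absorb n_l.
  apply: leq_trans n_greedy; rewrite !leq_mul2l !leq_add2l; apply/orP; right; apply/orP; right.
  by rewrite /w leq_add2r cardsU cR (Gk e0G) leq_subr.
case=> BR cB mB Babs.
move: BR; rewrite disjoint_setUr => /andP[BR Be].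
pose Z := ~: (B :|: (R :|: e0)).
have cZ : n - w <= #|Z|.
  rewrite cardsCs setCK leq_sub2l //.
  have := cardsU B (R :|: e0); have := cardsU R e0; rewrite cR (Gk e0G) /w.
  by move: cB; clear; lia.
(* At most [w] neighbours lie outside [Z], and [3 * (49/100 - 1/10) > 1]. *)
have [||Y [YZ cY mZY]] := @almost_perfect_matching V k G k3 Gk Z (delta - w).
- move=> S cS; have := deg cS; have := cardsID Z (nbr S).
  have: #|nbr S :\: Z| <= #|~: Z| by rewrite setDE subset_leq_card // subsetIr.
  have := cardsC Z; move: cZ; clear; move: (w) => w'; lia.
- have Zn : #|Z| <= n := max_card _.
  by move: Zn delta_large n_w n0; clear; move: (w) => w'; lia.
have BZ : B \subset ~: Z by rewrite setCK subsetUl.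
have RZ : R \subset ~: Z by rewrite setCK (subset_trans (subsetUl R e0)) ?subsetUr.
have eZ : e0 \subset ~: Z by rewrite setCK (subset_trans (subsetUr R e0)) ?subsetUr.
have dZ T U : T \subset ~: Z -> U \subset Z -> [disjoint U & T].
  by move=> TZ UZ; apply: disjointWl UZ _; rewrite disjoint_sym disjoints_subset.
have [dYB dYR dYe] := And3 (dZ _ _ BZ YZ) (dZ _ _ RZ YZ) (dZ _ _ eZ YZ).
have [c' cY'] : exists c, #|Y| = c * k.
  apply/dvdnP; have /(dvdn_card_matchable Gk) := mZY.
  rewrite cardsD (setIidPr YZ) => dv.
  have := dvdn_card_matchable Gk mB => dB.
  have : k %| #|Z|.
    have := cardsC Z; rewrite setCK !cardsU (disjoint_setI0 Re) cR (Gk e0G) cards0.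
    rewrite setIUr (disjoint_setI0 BR) (disjoint_setI0 Be) setU0 cards0 !subn0 => cZn.
    have: k %| #|Z| + (#|B| + (6 * k * k + k)) by rewrite cZn.
    by rewrite dvdn_addl // !dvdn_add // ?dvdn_mull.
  move=> dZk; have YZc := subset_leq_card YZ.
  by rewrite -(subKn YZc) dvdn_sub.
have c2 : c' <= 2 by move: cY; rewrite cY'; move: k3; clear; nia.
pose U0 := Y :|: R.
have cU0 : #|U0| = (c' + 6 * k) * k.
  by rewrite cardsU (disjoint_setI0 dYR) cards0 subn0 cY' cR mulnDl.
have YA : #|Y :&: A| <= 2 * k.
  apply: leq_trans (subset_leq_card (subsetIl _ _)) _.
  by rewrite cY' leq_mul2r c2 orbT.
have cardUI X U : [disjoint X & U] -> #|(X :|: U) :&: A| = #|X :&: A| + #|U :&: A|.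
  by move=> XU; rewrite setIUl cardsU setIACA (disjoint_setI0 XU) set0I cards0 subn0.
have cU0A : #|U0 :&: A| = i * (6 * k + 3) + #|Y :&: A| by rewrite cardUI // cRA addnC.
have ik : i <= k by apply: leq_trans idk; apply: leq_addr.
(* The excess of [#|U :&: A|] over [c * i] is at most [3 * i + 3 * k <= 6 * k <= c], so its quotient
   by [d] is an admissible number of larger pieces. *)
have range c U : c' + 6 * k <= c <= c' + 6 * k + 1 -> #|U| = c * k ->
    i * (6 * k + 3) <= #|U :&: A| <= i * (6 * k + 3) + 3 * k ->
    d %| #|U :&: A| - c * i -> splits good_type c U.
  move=> /andP[c1 c1'] cU /andP[u1 u2] /dvdnP[j cUA].
  have cik : c * i <= i * (6 * k + 3).
    by rewrite mulnC leq_mul2l; apply/orP; right; move: c1' c2; clear; lia.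
  apply: (@splits_types c j) => //; first by rewrite [d * j]mulnC -cUA subnKC // (leq_trans cik).
  have ci : 6 * k * i <= c * i by rewrite leq_mul2r; apply/orP; right; move: c1; clear; lia.
  have: j * d <= 6 * k by rewrite -cUA; move: u2 ci ik; clear; nia.
  by move: c1 d0; clear; nia.
have odd_range c U : c' + 6 * k <= c <= c' + 6 * k + 1 -> #|U| = c * k ->
    i * (6 * k + 3) <= #|U :&: A| <= i * (6 * k + 3) + 3 * k ->
    (d == 1) || (odd #|U :&: A| == odd (c * i)) -> splits good_type c U.
  move=> hc cU hu hd; apply: range => //.
  case/orP: hd => [/eqP->|/eqP hd]; first exact: dvd1n.
  have [->|->] : d = 1 \/ d = 2 by move: d0 d2; clear; lia.
    exact: dvd1n.
  have cik : c * i <= #|U :&: A|.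
    case/andP: hu => hu _; apply: leq_trans hu.
    by rewrite mulnC leq_mul2l; apply/orP; right; move: hc c2; clear; lia.
  by rewrite dvdn2 oddB // hd addbb.
have dBU : [disjoint B & U0] by rewrite disjoint_setUr BR disjoint_sym dYB.
have dUe : [disjoint U0 & e0] by rewrite disjoint_setUl dYe Re.
have splitV : [set: V] = (B :|: U0) :|: e0 :|: (Z :\: Y).
  apply/setP=> x; rewrite !inE.
  by case: (x \in B); case: (x \in R); case: (x \in e0); case: (x \in Y).
have dZrest : [disjoint (B :|: U0) :|: e0 & Z :\: Y].
  have DZ : Z :\: Y \subset Z by apply: subsetDl.
  have dT T : T \subset ~: Z -> [disjoint T & Z :\: Y] by rewrite disjoint_sym => /dZ ->.
  have dYZ : [disjoint Y & Z :\: Y].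
    by rewrite disjoints_subset; apply/subsetP=> x xY; rewrite in_setC in_setD xY.
  by rewrite !disjoint_setUl dYZ !(dT B, dT R, dT e0).
have U0bounds : i * (6 * k + 3) <= #|U0 :&: A| <= i * (6 * k + 3) + 2 * k.
  by rewrite cU0A leq_addr leq_add2l.
rewrite splitV; apply: matchableU => //.
have [hd|hd] := boolP ((d == 1) || (odd #|U0 :&: A| == odd ((c' + 6 * k) * i))).
  have sU0 : splits good_type (c' + 6 * k) U0.
    apply: odd_range => //; first by rewrite leqnn leq_addr.
    by move: U0bounds; clear; lia.
  apply: matchableU; [|exact: matchable_edge|by rewrite disjoint_setUl Be dUe].
  by apply: Babs sU0 => //; move: c2; clear; lia.
(* Including [e0] adds one piece and flips the parity of the excess, as [#|e0 :&: A|] and [i] differ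
   in parity. *)
have sU1 : splits good_type (c' + 6 * k + 1) (U0 :|: e0).
  have cUe : #|(U0 :|: e0) :&: A| = #|U0 :&: A| + #|e0 :&: A| by apply: cardUI.
  apply: odd_range; first by rewrite leqnn leq_addr.
  - by rewrite cardsU (disjoint_setI0 dUe) cards0 subn0 cU0 (Gk e0G) addn1 mulSn addnC.
  - have := subset_leq_card (subsetIl e0 A); rewrite (Gk e0G) cUe.
    by move: U0bounds; clear; lia.
  - move: hd; rewrite negb_or => /andP[d1 hd]; have d2' : d = 2 by move: d1 d0 d2; clear; lia.
    have := e0_parity d2'; move: hd; rewrite (negbTE d1) cUe !oddM !oddD /=.
    by case: (odd c'); case: (odd i); case: (odd _); case: (odd _); case: (odd _).
rewrite -setUA; apply: Babs sU1; first by move: c2; clear; lia.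
by rewrite disjoint_setUr dBU Be.
Qed.
End Endgame.

(** * Exchangeability classes *)

Section Classes.
Variables (V : finType) (k : nat) (G : {set {set V}}) (delta : nat).
Hypotheses (k3 : 3 <= k) (Gk : forall e, e \in G -> #|e| = k).
Implicit Types (x y z : V) (t : seq V) (A T : {set V}).
Local Notation n := #|V|.
Local Notation nbr := (nbr G).
Local Notation edge := (edge G).
Local Notation reach := (reach G).
Hypothesis deg : forall S : {set V}, #|S| = k.-1 -> delta <= #|nbr S|.
Hypotheses (delta_large : 49 * n <= 100 * delta) (n_large : 100 * (k * k) <= n).

Lemma sum_edge t : \sum_y (edge (y :: t) : nat) = #|nbr [set:: t]|.
Proof.
rewrite -sum1dep_card [RHS]big_mkcond; apply: eq_bigr => y _.
by rewrite edge_cons; case: (_ \in G).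
Qed.

Lemma sum_edge_ge t : size t = k.-1 -> uniq t -> delta <= \sum_y (edge (y :: t) : nat).
Proof.
by move=> st ut; rewrite sum_edge deg // cardsE; have /card_uniqP-> := ut.
Qed.

Definition degree x := tsum k.-1 (fun t => edge (x :: t)).

(** Almost all choices of [k - 2] further vertices are distinct from [x] and each other, and each of
    these extends in at least [delta] ways; [0.49 * 0.99 > 0.48]. *)
Lemma degree_ge x : 48 * n ^ k.-1 <= 100 * degree x.
Proof.
have n0 : 0 < n by apply/card_gt0P; exists x.
have [s ks] : exists s, k = s.+2 by exists (k - 2); lia.
have : delta * tsum s (fun t => fresh [set x] t) <= degree x.
  rewrite /degree ks /= -tsum_sum -tsumM; apply: leq_tsum => t st.
  case: (boolP (fresh _ t)) => [/andP[ut xt]|_]; last by rewrite muln0.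
  rewrite muln1; have := @sum_edge_ge (x :: t); rewrite /= ut andbT st ks => /(_ erefl).
  have -> : x \notin t by apply/negP => /(allP xt); rewrite /= !inE eqxx.
  move=> /(_ isT); congr (_ <= _); apply: eq_bigr => y _; congr nat_of_bool.
  by apply: edge_perm; apply: (permEl (perm_catCA [:: y] [:: x] t)).
have := tsum_not_fresh s [set x]; rewrite cards1.
have: tsum s (fun t => fresh [set x] t : nat) + tsum s (fun t => ~~ fresh [set x] t) = n ^ s.
  rewrite -tsumD -[RHS]muln1 -tsum_const; apply: eq_tsum => t _; by case: fresh.
have {ks} [-> ks2] : k.-1 = s.+1 /\ s * (s + 1) <= k * k by rewrite ks; split; nia.
rewrite expnS; set q := n ^ s; set F := tsum s _; set B := tsum s _ => FB Bn dF.
have B100 : 100 * B <= q.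
  rewrite -(leq_pmul2r n0) -mulnA (leq_trans (leq_mul (leqnn 100) Bn)) //.
  by rewrite mulnA mulnC leq_mul2l; apply/orP; right; move: ks2 n_large; clear; lia.
have F99 : 99 * q <= 100 * F by move: FB B100; clear; lia.
have := leq_mul delta_large F99; move: dF; clear; nia.
Qed.

Definition adj x y := n ^ k.-1 <= 100 * tsum k.-1 (fun t => edge (x :: t) && edge (y :: t)).

Lemma adjC x y : adj x y = adj y x.
Proof. by congr (_ <= _ * _); apply: eq_tsum => t _; rewrite andbC. Qed.

(* Three neighbourhoods of density close to 1/2 cannot be almost disjoint. *)
Lemma adj_triple x y z : [|| adj x y, adj x z | adj y z].
Proof.
apply/negPn/negP; rewrite !negb_or -!ltnNge => /and3P[xy xz yz].
have := degree_ge x; have := degree_ge y; have := degree_ge z.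
have: degree x + degree y + degree z <=
   n ^ k.-1 + (tsum k.-1 (fun t => edge (x :: t) && edge (y :: t)) +
   tsum k.-1 (fun t => edge (x :: t) && edge (z :: t)) +
   tsum k.-1 (fun t => edge (y :: t) && edge (z :: t))).
  rewrite -[n ^ _]muln1 -tsum_const -!tsumD; apply: leq_tsum => t _.
  by case: (edge (x :: t)); case: (edge (y :: t)); case: (edge (z :: t)).
move: xy xz yz; clear; lia.
Qed.

(** Double counting: each tuple completed by [x] is completed by at least [delta] vertices, while a
    vertex not adjacent to [x] shares fewer than [n ^ k.-1 / 100] tuples with it, a small part of
    [degree x]. *)
Lemma adj_degree x : 46 * n <= 100 * #|[set z | adj x z]|.
Proof.
have n0 : 0 < n by apply/card_gt0P; exists x.
pose I z := tsum k.-1 (fun t => edge (x :: t) && edge (z :: t)).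
have lo : delta * degree x <= \sum_z I z.
  rewrite -tsum_sum -tsumM; apply: leq_tsum => t st.
  have [xt|_] := boolP (edge (x :: t)); last by rewrite muln0.
  rewrite muln1 sum_edge_ge //.
  by have /= /andP[] : uniq (x :: t) by apply: (edge_uniq Gk _ xt); rewrite /= st; lia.
have hi : 100 * \sum_z I z <= 100 * (#|[set z | adj x z]| * degree x) + n * n ^ k.-1.
  rewrite big_distrr /= -sum1_card big_distrl big_distrr /= -sum_nat_const.
  rewrite [X in _ <= X + _]big_mkcond -big_split; apply: leq_sum => z _.
  rewrite inE /=; case: ifPn => [xz|]; last by rewrite /adj -ltnNge add0n => /ltnW.
  rewrite mul1n; apply: leq_trans (leq_addr _ _); rewrite leq_mul2l; apply/orP; right.
  by apply: leq_tsum => t _; case: (edge (x :: t)); case: edge.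
have N0 : 0 < degree x.
  have := degree_ge x; have : 0 < n ^ k.-1 by rewrite expn_gt0 n0.
  by clear; lia.
have dx := degree_ge x.
rewrite -(leq_pmul2r N0); move: lo hi dx delta_large.
set N := degree x; set a := #|_|; set b := \sum_z _; set q := n ^ _ => lo hi dx dl.
have := leq_mul (leqnn n) dx; have := leq_mul dl (leqnn N); move: lo hi; clear; nia.
Qed.

Lemma adj_reach x y : adj x y -> reach k.-1 100 x y.
Proof.
move=> xy; apply: leq_trans xy _; rewrite leq_mul2l; apply/orP; right.
apply: leq_tsum => t st; have [/andP[xt yt]|//] := boolP (_ && _).
by rewrite /swap !(mseq_edge Gk) //= st; lia.
Qed.

(** These are the gadget lengths and densities that [reach_comp] yields for chains of two and three
    adjacencies. *)
Definition chain2_size := (k.-1 + k.-1).+1.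
Definition chain3_size := (k.-1 + chain2_size).+1.
Definition chain2_const E := 2 * (E * (100 * 100)).
Definition chain3_const := 2 * (5 * (100 * chain2_const 5)).
Hypothesis n_comp : 2 * (5 * (100 * chain2_const 100)) * (chain3_size * (chain3_size + 2)) <= n.

Lemma adj_reach2 E x y :
  E <= 100 -> n <= E * #|[set z | adj x z && adj z y]| -> reach chain2_size (chain2_const E) x y.
Proof.
move=> E100 many; apply: reach_comp.
  apply: leq_trans many _; rewrite leq_mul2l; apply/orP; right.
  apply: subset_leq_card; apply/subsetP=> z; rewrite !inE => /andP[xz zy].
  by rewrite !adj_reach.
apply: leq_trans n_comp; apply: leq_mul.
  by rewrite leq_mul2l /chain2_const; move: E100; clear; lia.
by rewrite /chain3_size /chain2_size leq_mul //; lia.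
Qed.

(** If some [x0], [y0] have few common adjacent vertices, their non-adjacent vertices form two
    cliques [X], [Y] (by [adj_triple]) covering almost everything. Vertices with many adjacencies
    into the same clique are joined by chains of three. *)
Lemma reach_classes :
  (forall x y, reach chain2_size (chain2_const 100) x y) \/
  exists A, [/\ n <= 3 * #|A|, n <= 3 * #|~: A| &
    forall x y, (x \in A) = (y \in A) -> reach chain3_size chain3_const x y].
Proof.
have [/'forall_'forall_idP all2|] :=
  boolP [forall x, forall y, n <= 100 * #|[set z | adj x z && adj z y]|].
  by left=> x y; apply: adj_reach2.
rewrite negb_forall => /existsP[x0]; rewrite negb_forall => /existsP[y0].
rewrite -ltnNge => few; right.
pose X := [set z | ~~ adj x0 z]; pose Y := [set z | ~~ adj y0 z].
have cliqueX x y : x \in X -> y \in X -> adj x y.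
  by rewrite !inE => /negbTE nx /negbTE ny; have := adj_triple x0 x y; rewrite nx ny.
have cliqueY x y : x \in Y -> y \in Y -> adj x y.
  by rewrite !inE => /negbTE nx /negbTE ny; have := adj_triple y0 x y; rewrite nx ny.
have XY : 100 * #|~: (X :|: Y)| < n.
  congr (_ * _ < _): few; apply: eq_card => z; rewrite !inE negb_or !negbK.
  by rewrite [adj z _]adjC.
have cX : 100 * #|X| <= 54 * n.
  have := cardsC X; rewrite (_ : ~: X = [set z | adj x0 z]); last first.
    by apply/setP=> z; rewrite !inE negbK.
  by have := adj_degree x0; clear; lia.
have cY : 100 * #|Y| <= 54 * n.
  have := cardsC Y; rewrite (_ : ~: Y = [set z | adj y0 z]); last first.
    by apply/setP=> z; rewrite !inE negbK.
  by have := adj_degree y0; clear; lia.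
have cXY := cardsC (X :|: Y).
have cU := cardsUI X Y.
(* Of the [0.46 * n] vertices adjacent to [z], at most [0.01 * n] lie outside both cliques. *)
have manyXY z : (n <= 5 * #|X :&: [set w | adj z w]|) || (n <= 5 * #|Y :&: [set w | adj z w]|).
  have := adj_degree z; set N := [set w | adj z w] => cN.
  have : #|N| <= #|X :&: N| + #|Y :&: N| + #|~: (X :|: Y)|.
    rewrite -[leqLHS](cardsID (X :|: Y)) leq_add //.
      by rewrite setIC setIUl cardsU leq_subr.
    by rewrite setDE subset_leq_card ?subsetIr.
  by move: cN XY; clear; lia.
have big : 2 * (5 * (100 * chain2_const 5)) * (chain3_size * (chain3_size + 2)) <= n.
  by apply: leq_trans n_comp; rewrite leq_mul2r; apply/orP; right; rewrite /chain2_const; lia.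
have reachC (C : {set V}) x y : {in C &, forall a b, adj a b} ->
    n <= 5 * #|C :&: [set w | adj x w]| -> n <= 5 * #|C :&: [set w | adj y w]| ->
    reach chain3_size chain3_const x y.
  move=> clC manyx manyy; apply: reach_comp; last exact: big.
  apply: leq_trans manyx _; rewrite leq_mul2l; apply/orP; right.
  apply: subset_leq_card; apply/subsetP=> a; rewrite !inE => /andP[aC xa].
  rewrite adj_reach //=; apply: adj_reach2 => //.
  apply: leq_trans manyy _; rewrite leq_mul2l; apply/orP; right.
  apply: subset_leq_card; apply/subsetP=> b; rewrite !inE => /andP[bC yb].
  by rewrite clC //= adjC.
have selfX z : z \in X -> X :&: [set w | adj z w] = X.
  by move=> zX; apply/setIidPl/subsetP=> w wX; rewrite inE cliqueX.
have selfY z : z \in Y -> Y :&: [set w | adj z w] = Y.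
  by move=> zY; apply/setIidPl/subsetP=> w wY; rewrite inE cliqueY.
(* Every vertex is put on the side of a clique it sees well; members of a clique see all of it, at
   least [0.45 * n] vertices. *)
pose A := X :|: [set z | (z \notin Y) && (n <= 5 * #|X :&: [set w | adj z w]|)].
have Ain z : z \in A -> n <= 5 * #|X :&: [set w | adj z w]|.
  rewrite in_setU => /orP[/selfX->|]; last by rewrite inE => /andP[].
  by move: XY cX cY cXY cU; clear; lia.
have Aout z : z \notin A -> n <= 5 * #|Y :&: [set w | adj z w]|.
  rewrite in_setU negb_or => /andP[_]; have [/selfY-> _|zY] := boolP (z \in Y).
    by move: XY cX cY cXY cU; clear; lia.
  by rewrite inE zY /= => nz; have := manyXY z; rewrite (negbTE nz).
exists A; split.
- have : #|X| <= #|A| by apply/subset_leq_card/subsetUl.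
  by move: XY cX cY cXY cU; clear; lia.
- have : #|Y :\: X| <= #|~: A|.
    apply/subset_leq_card/subsetP=> z; rewrite in_setD => /andP[zX zY].
    by rewrite in_setC in_setU negb_or zX inE zY.
  by have := cardsID X Y; rewrite setIC; move: XY cX cY cXY cU; clear; lia.
- move=> x y; case: (boolP (x \in A)) => xA /esym yA.
    by apply: (reachC X) => //; exact: Ain.
  by apply: (reachC Y) => //; apply: Aout => //; rewrite yA.
Qed.

End Classes.

(** * Types of edges with respect to a vertex class *)

Section Types.
Variables (V : finType) (k : nat) (G : {set {set V}}) (delta : nat).
Hypotheses (k3 : 3 <= k) (Gk : forall e, e \in G -> #|e| = k).
Implicit Types (x y z : V) (t : seq V) (A T : {set V}).
Local Notation n := #|V|.
Local Notation nbr := (nbr G).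
Local Notation edge := (edge G).
Local Notation reach := (reach G).
Hypothesis deg : forall S : {set V}, #|S| = k.-1 -> delta <= #|nbr S|.
Hypothesis delta_large : 49 * n <= 100 * delta.

(** Vertices of [A] are listed first, so a type is counted through one fixed order. *)
Definition type_pattern i r := nseq i true ++ nseq r false.

Lemma tsum_pattern A (p : seq bool) :
  n <= 3 * #|A| -> n <= 3 * #|~: A| ->
  n ^ size p <= 3 ^ size p * tsum (size p) (fun t => map (mem A) t == p).
Proof.
move=> nA nAC; elim: p => [|b p IHp] //=.
rewrite (eq_bigr (fun x => (x \in A == b) *
    tsum (size p) (fun t => map (mem A) t == p : nat))); last first.
  by move=> x _; rewrite -tsumM; apply: eq_tsum => t _; rewrite mulnb.
rewrite -big_distrl /= !expnS mulnACA leq_mul //.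
case: b; [move: nA|move: nAC]; congr (_ <= _ * _).
  by rewrite -sum1_card big_mkcond; apply: eq_bigr => x _ /=; case: (x \in A).
by rewrite -sum1_card big_mkcond; apply: eq_bigr => x _ /=; rewrite inE; case: (x \in A).
Qed.

Definition num_edges_of_type A i :=
  tsum k (fun t => edge t && (map (mem A) t == type_pattern i (k - i))).

(** Choosing [k - 1] vertices with prescribed sides and then a neighbour costs a factor 3 each; the
    4 pays for discarding repetitions and for keeping the better of two types. *)
Definition dense_type A i := n ^ k <= 4 * 3 ^ k * num_edges_of_type A i.

(* Inserting a neighbour [y] of a (k-1)-tuple with i vertices in A between its
   two blocks yields an edge of type i + 1 or i according to whether y is in A. *)
Lemma dense_type_next A i :
  n <= 3 * #|A| -> n <= 3 * #|~: A| -> 4 * 3 ^ k * (k * k) <= n -> i < k ->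
  dense_type A i || dense_type A i.+1.
Proof.
move=> nA nAC big ik; pose r := k.-1 - i.
have kE : k = i + r.+1 by rewrite /r; lia.
have k1E : k.-1 = i + r by rewrite kE addnS.
pose P t := map (mem A) t == type_pattern i r.
have dP : n ^ k.-1 <= 3 ^ k.-1 * tsum k.-1 (fun t => P t : nat).
  have := @tsum_pattern A (type_pattern i r) nA nAC.
  by rewrite /type_pattern size_cat !size_nseq -k1E.
have {}dP : n ^ k.-1 <= 2 * 3 ^ k.-1 * tsum k.-1 (fun t => P t && fresh set0 t).
  apply: tsum_fresh dP; rewrite cards0 addn0; apply: leq_trans big.
  by apply: leq_mul; [rewrite leq_mul ?leq_exp2l //; lia|rewrite leq_mul //; lia].
have ins : delta * tsum k.-1 (fun t => P t && fresh set0 t) <=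
    num_edges_of_type A i + num_edges_of_type A i.+1.
  rewrite /num_edges_of_type -tsumD -tsumM k1E {1}[k]kE !tsum_cat.
  apply: leq_tsum => t1 st1 /=; rewrite -tsum_sum; apply: leq_tsum => t2 st2.
  have [/andP[/eqP Pt /andP[ut _]]|_] := boolP (_ && _); last by rewrite muln0.
  rewrite muln1; apply: leq_trans (sum_edge_ge deg _ ut) _.
    by rewrite size_cat st1 st2.
  apply: leq_sum => y _.
  rewrite (_ : edge (y :: t1 ++ t2) = edge (t1 ++ y :: t2)); last first.
    by apply: edge_perm; apply: permEl (perm_catCA [:: y] t1 t2).
  case: edge => //=.
  have [m1 m2] : map (mem A) t1 = nseq i true /\ map (mem A) t2 = nseq r false.
    move/eqP: Pt; rewrite /type_pattern map_cat eqseq_cat ?size_map ?size_nseq //.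
    by case/andP=> /eqP-> /eqP->.
  rewrite map_cat /= m1 m2 /type_pattern (_ : k - i = r.+1) 1?(_ : k - i.+1 = r); try lia.
  have [yA|yA] := boolP (y \in A); last by rewrite /= eqxx.
  rewrite (_ : nseq i true ++ true :: _ = nseq i.+1 true ++ nseq r false).
    by rewrite [X in _ + nat_of_bool X]eqxx addn1.
  by elim: (i) => //= j ->.
have k1 : k = k.-1.+1 by lia.
rewrite /dense_type; move: ins dP delta_large; rewrite {5 6 7 8}k1 !expnS.
set X := num_edges_of_type A i; set X' := num_edges_of_type A i.+1.
set N := n ^ _; set c := 3 ^ _; set F := tsum _ _ => ins dP dl.
suff: n * N <= 2 * (3 * c) * (X + X').
  by case: (leqP X X') => XX' h; apply/orP; [right|left]; move: h XX'; clear; nia.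
have h1 := leq_mul (leqnn n) dP; have h2 := leq_mul (leqnn (2 * (3 * c))) ins.
apply: leq_trans h1 _; apply: leq_trans h2.
have : n <= 3 * delta by move: dl; clear; lia.
by move/(leq_mul (leqnn (2 * c * F))); clear; nia.
Qed.

(** Types 1 and 2 decide: if 1 is not dense, 0 and 2 are; if 1 is but 2 is not, 3 is. *)
Lemma dense_types A :
  n <= 3 * #|A| -> n <= 3 * #|~: A| -> 4 * 3 ^ k * (k * k) <= n ->
  exists i d, [/\ 0 < d, d <= 2, i + d <= k, dense_type A i & dense_type A (i + d)].
Proof.
move=> nA nAC big; have next := dense_type_next nA nAC big.
have d01 : dense_type A 0 || dense_type A 1 by apply: next; lia.
have d12 : dense_type A 1 || dense_type A 2 by apply: next; lia.
have d23 : dense_type A 2 || dense_type A 3 by apply: next; lia.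
have [d1|d1] := boolP (dense_type A 1); last first.
  by rewrite (negbTE d1) /= in d01 d12; rewrite orbF in d01; exists 0, 2; split=> //; lia.
have [d2|d2] := boolP (dense_type A 2); first by exists 1, 1; split=> //; lia.
by exists 1, 2; rewrite (negbTE d2) in d23; split=> //; lia.
Qed.

Definition gadget_size s := k + k * s.
Definition gadget_const D := 2 * (4 * 3 ^ k * D ^ k).

(** Listing the vertices of [T] in [A] first gives the pattern counted by [dense_type], so the edges
    of that type serve as leading edges in [tsum_absorb]. *)
Lemma dense_type_absorb s D A T :
  (forall x y, (x \in A) = (y \in A) -> reach s D x y) ->
  #|T| = k -> dense_type A #|T :&: A| ->
  gadget_const D * (gadget_size s * (gadget_size s + k)) <= n ->
  n ^ gadget_size s <= gadget_const D * tsum (gadget_size s) (fun t => absorb G T t).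
Proof.
move=> rA cT dT big; pose vs := enum (T :&: A) ++ enum (T :\: A).
have vsT : [set:: vs] = T.
  by apply/setP=> x; rewrite inE mem_cat !mem_enum !inE; case: (x \in A); case: (x \in T).
have svs : size vs = k by rewrite size_cat -!cardE cardsID.
have uvs : uniq vs.
  rewrite cat_uniq !enum_uniq andbT; apply/hasPn=> x; rewrite !mem_enum !inE.
  by case/andP=> /negbTE->; rewrite andbF.
have map_vs : map (mem A) vs = type_pattern #|T :&: A| (k - #|T :&: A|).
  have map_const (X : {set V}) b :
      {in X, forall x, (x \in A) = b} -> map (mem A) (enum X) = nseq #|X| b.
    move=> XA; rewrite cardE -(size_map (mem A)); apply/all_pred1P/allP=> y.
    by case/mapP=> x; rewrite mem_enum => /XA xA ->; apply/eqP.
  rewrite map_cat /type_pattern -cT -cardsD -!map_const // => x; rewrite inE.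
    by case/andP=> /negbTE.
  by case/andP.
rewrite -vsT; apply: (tsum_absorb k3 Gk (c := mem A)) => //.
by rewrite map_vs.
Qed.

(** An exponent [l] with [n ^ k < 2 ^ l], as [absorber] requires. *)
Definition absorber_log := (k * (trunc_log 2 n).+1).
Definition reserve_size m D := 6 * k * k + k + (6 * k + 3) * (m * (2 * D * absorber_log)).
Definition large_for s D :=
  let m := gadget_size s in let D' := gadget_const D in
  (10 * reserve_size m D' <= n) && (2 * D' * (m * (m + reserve_size m D')) <= n).

Lemma perfect_matching_of_types s D A i d e0 :
  k %| n -> 0 < D -> large_for s D ->
  (forall x y, (x \in A) = (y \in A) -> reach s D x y) ->
  0 < d -> d <= 2 -> i + d <= k -> (forall T, good_type k A i d T -> dense_type A #|T :&: A|) ->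
  e0 \in G -> (d = 2 -> odd #|e0 :&: A| != odd i) ->
  i * (6 * k + 3) <= #|A :\: e0| -> 6 * k * k <= #|~: A :\: e0| ->
  matchable G [set: V].
Proof.
move=> kn D0 /andP[nw nm] rA d0 d2 idk dT e0G e0p Al ACl.
have n0 : 0 < n by apply: leq_trans (max_card (mem e0)); rewrite (Gk e0G); lia.
have nl : n ^ k < 2 ^ absorber_log.
  by rewrite /absorber_log mulnC expnM ltn_exp2r ?trunc_log_ltn //; lia.
apply: (perfect_matching_of_absorption k3 Gk idk _ d0 d2 _ deg delta_large kn
  e0G e0p Al ACl nl nw nm).
  by rewrite /gadget_const !muln_gt0 !expn_gt0 D0.
move=> T gT; apply: (dense_type_absorb rA); last 1 first.
- apply: leq_trans nm; rewrite -mulnA; apply: leq_trans (leq_pmull _ _) => //.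
  by rewrite !leq_mul2l leq_add2l /reserve_size; apply/orP; right; apply/orP; right; lia.
- by case/andP: gT => /eqP.
- exact: dT.
Qed.

Hypothesis n_large : 100 * (k * k) <= n.

(** Serves the case of a single exchangeability class: relative to the empty set all edges have type
    0, so the overall edge density suffices. *)
Lemma dense_type0 : dense_type set0 0.
Proof.
rewrite /dense_type /num_edges_of_type /type_pattern subn0 /=.
have -> : tsum k (fun t => edge t && (map (mem set0) t == nseq k false)) =
          \sum_x degree k G x.
  rewrite -tsum_sum; have {1 2}-> : k = k.-1.+1 by lia.
  rewrite /= tsum_sum; apply: eq_bigr => x _; apply: eq_tsum => t st.
  rewrite inE eqseq_cons /= (_ : map _ t == _); first by rewrite andbT.
  by rewrite -st; apply/eqP; elim: (t) => //= y t' ->; rewrite inE.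
have {1}-> : k = k.-1.+1 by lia.
rewrite expnS -sum_nat_const big_distrr; apply: leq_sum => x _ /=.
have := degree_ge k3 deg delta_large n_large x.
have h27 : 27 <= 3 ^ k by rewrite (@leq_exp2l 3 3).
have := leq_mul h27 (leqnn (degree k G x)); rewrite -[4 * _ * _]mulnA.
by set X := 3 ^ k * _; set N := n ^ _; clearbody X N; clear; lia.
Qed.

End Types.

(** * The dichotomy *)

Lemma linear_log_bound a b :
  exists n0, forall n, n0 <= n -> a + b * (trunc_log 2 n).+1 <= n.
Proof.
(* This forces [t >= a + b + 5] for [t = trunc_log 2 n], whence
   [a + b * t.+1 <= t * t.+1 <= 2 ^ t <= n]. *)
exists (2 ^ (a + b + 5)) => n le_n.
have n0 : 0 < n by apply: leq_trans le_n; rewrite expn_gt0.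
have q_t := trunc_log_max (isT : 1 < 2) le_n.
apply: leq_trans (trunc_logP (isT : 1 < 2) n0).
set t := trunc_log 2 n in q_t *.
have tt : t * t.+1 <= 2 ^ t.
  have -> : t = (t - 5) + 5 by lia.
  elim: (t - 5) => // u IHu; rewrite addSn expnS; nia.
by apply: leq_trans tt; nia.
Qed.

(** For fixed parameters the reserve and the absorbers take only [O(log n)] vertices. *)
Lemma large_for_eventually k s D :
  exists n0, forall V : finType, n0 <= #|V| -> large_for V k s D.
Proof.
pose m := gadget_size k s; pose D' := gadget_const k D.
pose K := 10 + 2 * D' * m; pose c1 := 6 * k * k + k.
pose c2 := (6 * k + 3) * (m * (2 * D' * k)).
have [n0 n0P] := linear_log_bound (K * (m + c1)) (K * c2).
exists n0 => V /n0P; set L := (trunc_log 2 _).+1 => le_n.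
have wE : reserve_size V k m D' = c1 + c2 * L.
  by rewrite /reserve_size /absorber_log -/L /c1 /c2 -!mulnA.
have {}le_n : K * (m + reserve_size V k m D') <= #|V|.
  by apply: leq_trans _ le_n; rewrite wE addnA mulnDr [K * (c2 * L)]mulnA.
rewrite /large_for -/m -/D'; apply/andP; split; apply: leq_trans _ le_n.
  by apply: leq_mul; [exact: leq_addr|exact: leq_addl].
by rewrite [leqLHS]mulnA; apply: leq_mul; [exact: leq_addl|exact: leqnn].
Qed.

Section Dichotomy.
Variables (V : finType) (k : nat) (G : {set {set V}}) (delta : nat).
Hypotheses (k3 : 3 <= k) (Gk : forall e, e \in G -> #|e| = k).
Local Notation n := #|V|.
Hypothesis deg : forall S : {set V}, #|S| = k.-1 -> delta <= #|nbr G S|.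
Hypothesis n_large : 100 * (k * k) <= n.

(** The parity of [#|S :&: A|] forces all neighbours of a (k-1)-set [S] onto one side of [A]; both
    parities occur since both sides are large. *)
Lemma parity_class_size (A : {set V}) (a : bool) :
  n <= 3 * #|A| -> n <= 3 * #|~: A| ->
  (forall e, e \in G -> odd #|e :&: A| = a) -> delta <= #|A| /\ delta <= #|~: A|.
Proof.
move=> nA nAC par.
have get (b : bool) : exists2 S : {set V}, #|S| = k.-1 & #|S :&: A| = b.
  have [||S [_ cS cSA]] := @subset_of_type V A setT b (k.-1 - b).
  - by rewrite setTI; case: b; nia.
  - by rewrite setTD; nia.
  by exists S; rewrite // cS subnKC //; move: k3; case: (b); clear; lia.
have nbrA (S : {set V}) y : #|S| = k.-1 -> y \in nbr G S ->
    (y \in A) (+) odd #|S :&: A| = a.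
  move=> cS yS; have yNS := nbr_notin k3 Gk cS yS; move: yS; rewrite inE => /par <-.
  have [yA|yA] := boolP (y \in A).
    rewrite setIUl (_ : [set y] :&: A = [set y]); last by apply/setIidPl; rewrite sub1set.
    by rewrite cardsU1 inE (negbTE yNS).
  rewrite setIUl (_ : [set y] :&: A = set0) ?set0U //.
  by apply: disjoint_setI0; rewrite disjoints1.
split.
  have [S cS cSA] := get (~~ a); apply: leq_trans (deg cS) _.
  apply/subset_leq_card/subsetP=> y /(nbrA S y cS); rewrite cSA oddb.
  by case: (y \in A) => //=; case: (a).
have [S cS cSA] := get a; apply: leq_trans (deg cS) _.
apply/subset_leq_card/subsetP=> y /(nbrA S y cS); rewrite cSA oddb inE.
by case: (y \in A) => //=; case: (a).
Qed.

Hypotheses (delta_large : 49 * n <= 100 * delta) (kn : k %| n).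
Hypothesis n_comp : 2 * (5 * (100 * chain2_const 100)) * (chain3_size k * (chain3_size k + 2)) <= n.
Hypothesis n_dense : 4 * 3 ^ k * (k * k) <= n.
Hypotheses (large2 : large_for V k (chain2_size k) (chain2_const 100))
  (large3 : large_for V k (chain3_size k) chain3_const).

Lemma matchable_or_parity :
  matchable G [set: V] \/
  exists (A : {set V}) (a : bool), [/\ delta <= #|A|, delta <= #|~: A| &
    forall e, e \in G -> odd #|e :&: A| = a].
Proof.
have [reach_all|[A [nA nAC rA]]] :=
  reach_classes k3 Gk deg delta_large n_large n_comp.
  left; have [e0 e0G] : exists e, e \in G.
    have [|S _ cS] := @subset_of_card V setT k.-1; first by rewrite cardsT; nia.
    have : 0 < #|nbr G S| by apply: leq_trans (deg cS); nia.
    by case/card_gt0P=> y; rewrite inE; exists (y |: S).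
  (* Taking [d = 1] makes the parity condition on [e0] vacuous; relative to the empty set every
     [k]-set has type 0. *)
  apply: (perfect_matching_of_types (A := set0) (i := 0) (d := 1) (s := chain2_size k)
            (D := chain2_const 100)
            k3 Gk deg delta_large kn _ _ _ _ _ _ _ e0G) => //.
  - by move: k3; clear; lia.
  - by move=> T _; rewrite setI0 cards0; apply: dense_type0 deg delta_large n_large.
  - by rewrite setC0 setTD; have := cardsC e0; rewrite (Gk e0G); move: n_large k3; clear; nia.
have [i [d [d0 d2 idk di did]]] := dense_types k3 deg delta_large nA nAC n_dense.
have conclude e0 : e0 \in G -> (d = 2 -> odd #|e0 :&: A| != odd i) -> matchable G [set: V].
  move=> e0G e0p.
  apply: (perfect_matching_of_types (A := A) (i := i) (d := d) (s := chain3_size k)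
            (D := chain3_const)
            k3 Gk deg delta_large kn _ large3 rA d0 d2 idk _ e0G e0p) => //.
  - by move=> T /andP[_ /orP[/eqP->|/eqP->]].
  - have := cardsID e0 A; have := subset_leq_card (subsetIr A e0); rewrite (Gk e0G).
    by move: nA n_large k3 idk d0; clear; nia.
  - have := cardsID e0 (~: A); have := subset_leq_card (subsetIr (~: A) e0).
    by rewrite (Gk e0G); move: nAC n_large k3; clear; nia.
(* Either some edge can correct the parity, or all edges have the parity of [i] on [A]. *)
have [/exists_inP[e0 e0G e0p]|] := boolP [exists e in G, odd #|e :&: A| != odd i].
  by left; apply: conclude e0G _.
rewrite negb_exists_in => /forall_inP par; right; exists A, (odd i).
have {}par e : e \in G -> odd #|e :&: A| = odd i by move/par; rewrite negbK => /eqP.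
by have [] := parity_class_size nA nAC par.
Qed.

End Dichotomy.

(** * From minimum degree to neighbourhoods, and the theorem *)

Lemma codeg_le_nbr n k (G : {set {set 'I_n}}) (S : {set 'I_n}) :
  3 <= k -> kgraph k G -> #|S| = k.-1 -> codeg G S <= #|nbr G S|.
Proof.
move=> k3 Gk cS; apply: leq_trans (leq_imset_card (fun y => y |: S) _).
apply/subset_leq_card/subsetP=> e; rewrite inE => /andP[eG Se].
have /eqP/cards1P[y ey] : #|e :\: S| = 1.
  by rewrite cardsD (setIidPr Se) (Gk e eG) cS; move: k3; clear; lia.
have eE : e = y |: S by rewrite -ey setUC -{1}(setID e S) (setIidPr Se).
by apply/imsetP; exists y => //; rewrite inE -eE.
Qed.

Lemma mindeg_le_codeg n k (G : {set {set 'I_n}}) (S : {set 'I_n}) :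
  #|S| = k.-1 -> mindeg k G <= codeg G S.
Proof.
move=> /eqP cS; rewrite /mindeg; have := mem_index_enum S.
elim: (index_enum _) => //= T r IHr; rewrite inE big_cons => /orP[/eqP<-|/IHr le_r].
  by rewrite cS geq_minl.
by case: ifP => // _; apply: leq_trans (geq_minr _ _) le_r.
Qed.

(* MathComp's [ring_scope] has taken over the key [R]. *)
Delimit Scope R_scope with R.

Theorem theorem8p19 :
  forall k : nat, (3 <= k)%N ->
  exists c0 : R, (0 < c0)%R /\
  forall c : R, (0 < c)%R -> (c < c0)%R ->
  exists n0 : nat, forall n : nat, (n0 <= n)%N -> (k %| n)%N ->
  forall G : {set {set 'I_n}},
    kgraph k G ->
    ((/2 - c) * INR n <= INR (mindeg k G))%R ->
    ~ has_perfect_matching G ->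
    exists (V1 : {set 'I_n}) (a : bool),
      (mindeg k G <= #|V1|)%N /\ (mindeg k G <= #|~: V1|)%N /\
      (forall e, e \in G -> odd #|e :&: V1| = a).
Proof.
(* For [c < 1/100] the degree hypothesis gives the density [49/100] assumed in [delta_large]. *)
move=> k k3; exists (/ 100)%R; split; first lra.
move=> c c0 c100.
have [n2 n2P] := large_for_eventually k (chain2_size k) (chain2_const 100).
have [n3 n3P] := large_for_eventually k (chain3_size k) chain3_const.
pose N := 2 * (5 * (100 * chain2_const 100)) * (chain3_size k * (chain3_size k + 2)).
exists (n2 + n3 + (100 * (k * k) + N + 4 * 3 ^ k * (k * k))) => n le_n kn G Gk dG noPM.
have dl : 49 * n <= 100 * mindeg k G.
  apply/leP/INR_le; rewrite -!multE !mult_INR.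
  have -> : INR 49 = 49%R by rewrite INR_IZR_INZ.
  have -> : INR 100 = 100%R by rewrite INR_IZR_INZ.
  have := pos_INR n; nra.
have deg (S : {set 'I_n}) : #|S| = k.-1 -> mindeg k G <= #|nbr G S|.
  by move=> cS; apply: leq_trans (mindeg_le_codeg G cS) (codeg_le_nbr k3 Gk cS).
have [] := @matchable_or_parity 'I_n k G (mindeg k G) k3 Gk deg; rewrite ?card_ord //.
- by move: le_n; clear; lia.
- by apply: leq_trans le_n; rewrite -/N; clear; lia.
- by move: le_n; clear; lia.
- by apply: n2P; rewrite card_ord; move: le_n; clear; lia.
- by apply: n3P; rewrite card_ord; move: le_n; clear; lia.
- by case/existsP=> M /and3P[MG tM /eqP cM]; case: noPM; exists M.
by case=> A [a [dA dAC par]]; exists A, a.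
Qed.
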